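(* Let $C$ be a nonempty, convex, and weakly compact subset of a separable normed space $X$. Let $\Phi: C \rightrightarrows X$ be such that (i) $\Phi(x)$ is nonempty and convex for every $x \in C$; (ii) $\Phi(C)$ is relatively weakly compact; (iii) $\Phi$ is sequentially weakly lower semicontinuous (at every $x\in C$); (iv) $\Phi$ is weakly closed. Let $T:X\rightrightarrows X^*$ with $\Phi(C)\subseteq \mathrm{dom}(T)$ satisfy the following properties: (a) $T$ is s-$w^*$-closed on $\Phi(C)$; (b) $T$ is bounded; (c) $T$ is of type $S_+$ on $\Phi(C)$. If a sequence $\{x_n\}$ generated by Algorithm 1 (applied to the bifunction $G_T$ and the map $\Phi$) is asymptotically regular, then it admits a weak limit point which is a projected solution of $QVI(T,\Phi)$.
   Context: Spaces are real, $X^*$ is the topological dual of $X$; $\to^s$, $\to^w$, $\to^{w^*}$ denote strong, weak and weak$^*$ convergence. $\Phi(C)=\bigcup_{x\in C}\Phi(x)$ and $\mathrm{dom}(T)=\{x:T(x)\ne\emptyset\}$. $\Phi:C\rightrightarrows X$ is sequentially weakly lower semicontinuous at $x\in C$ if for every sequence $\{x_n\}\subseteq C$ with $x_n\to^w x$ and every $y\in\Phi(x)$ there exist a subsequence $\{x_{n_k}\}$ and $y_k\in\Phi(x_{n_k})$ with $y_k\to^s y$. $\Phi$ is weakly closed if its graph is a weakly closed subset of $C\times X$. For $D\subseteq\mathrm{dom}(T)$: $T$ is s-$w^*$-closed on $D$ if for all $x_n\in D$, $x_n^*\in T(x_n)$ with $x_n\to^s x\in D$ and $x_n^*\to^{w^*}x^*$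 one has $x^*\in T(x)$. $T$ is bounded if it maps bounded subsets of its domain into bounded subsets of $X^*$. $T$ is of type $S_+$ on $D$ if for every $\{x_n\}\subseteq D$ with $x_n\to^w x\in D$, if there exist $x_n^*\in T(x_n)$ with $\liminf_{n\to\infty}\langle x_n^*,x-x_n\rangle\ge 0$, then $x_n\to^s x$. $G_T(x,y)=\sup_{x^*\in T(x)}\langle x^*,y-x\rangle$. For $x\in C$ let $S(x)$ be the set of $z\in\Phi(x)$ such that $G_T(z,y)=\sup_{x^*\in T(z)}\langle x^*,y-z\rangle\ge 0$ for all $y\in\Phi(x)$. The metric projection is $P_C(x)=\{z\in C:\|x-z\|\le\|x-w\|\ \text{for all } w\in C\}$. A point $x_0\in C$ is a projected solution of the quasi variational inequality $QVI(T,\Phi)$ if there exists $z_0\in S(x_0)$ with $x_0\in P_C(z_0)$. Algorithm 1 (for $G_T$ and $\Phi$): for $i=0$ choose $x_0\in C$; given $x_i$, choose a point $z_i\in S(x_i)$ and choose $x_{i+1}\in P_C(z_i)$; if $x_{i+1}=x_i$ stop, otherwise increase $i$ by 1 and repeat. If the algorithm stops at step $i$, the generated sequence is understood to be continued constantly, $x_j=x_i$ for $j\ge i$. A sequence $\{x_n\}$ is asymptotically regular if $\lim_{n\to\infty}\|x_n-x_{n+1}\|=0$. A weak limit point of a sequence is the weak limit of one of its subsequences. *)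

(* Defs.v *)
From HB Require Import structures.
From mathcomp Require Import all_boot all_order all_algebra.
From mathcomp Require Import all_classical all_reals all_analysis.

Set Implicit Arguments.
Unset Strict Implicit.
Unset Printing Implicit Defensive.

Import Order.TTheory GRing.Theory Num.Theory.
Import numFieldNormedType.Exports.

Local Open Scope classical_set_scope.
Local Open Scope ring_scope.

Reserved Notation "{ 'weak' , F --> x }"
  (at level 0, F at level 69, format "{ 'weak' ,  F  -->  x }").
Reserved Notation "{ 'weak*' , F --> f }"
  (at level 0, F at level 69, format "{ 'weak*' ,  F  -->  f }").

Definition separable (X : topologicalType) :=
  exists2 D : set X, countable D & dense D.

Section Dual.
Context {R : realType}.

Record dual (X : normedModType R) := Dual {
  dual_linear :> {linear X -> R^o};
  dual_continuous : continuous dual_linear }.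

(* The supremum is finite for every f : dual X, by continuity. *)
Definition dual_norm (X : normedModType R) (f : dual X) : R :=
  sup [set `|f x| | x in [set x : X | `|x| <= 1]].

Definition dual_bounded (X : normedModType R) (A : set (dual X)) :=
  exists M : R, forall f, A f -> dual_norm f <= M.

(* X with its weak topology, the coarsest one making every f : dual X
   continuous. *)
Definition weak_space (X : normedModType R) : Type := X.

HB.instance Definition _ (X : normedModType R) :=
  Topological.copy (weak_space X)
    (sup_topology (fun f : dual X =>
       Topological.class (initial_topology (f : X -> R^o)))).

End Dual.

Notation "{ 'weak' , F --> x }" :=
  (cvg_to F (nbhs (x : weak_space _))) : classical_set_scope.

(* The weak* topology is the one induced on the dual by the topology of
   pointwise convergence. *)
Notation "{ 'weak*' , F --> f }" :=
  {ptws, (fun g => dual_linear g : _ -> _) @ F --> (dual_linear f : _ -> _)}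
  : classical_set_scope.

Section SetValuedMaps.
Context {R : realType} {X : normedModType R}.

(* A set-valued map Phi from C to X is a function X -> set X of which only the
   values at points of C are ever used. *)
Implicit Types (C D : set X) (Phi : X -> set X) (T : X -> set (dual X)).

Definition image_set C Phi : set X := \bigcup_(x in C) Phi x.

Definition dom T : set X := [set x | T x !=set0].

Definition seq_weakly_lsc_at C Phi (x : X) :=
  forall x_ : X ^nat, (forall n, C (x_ n)) -> {weak, x_ @ \oo --> x} ->
  forall y, Phi x y ->
  exists k : nat -> nat, increasing_seq k /\
  exists y_ : X ^nat, (forall n, Phi (x_ (k n)) (y_ n)) /\ y_ @ \oo --> y.

(* Closedness is relative to C x X: in the library, a set is closed in
   [subspace A] iff its trace on A is that of a closed set. *)
Definition weakly_closed C Phi :=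
  closed ([set p | C p.1 /\ Phi p.1 p.2] :
    set (subspace (C `*` setT : set (weak_space X * weak_space X)))).

Definition s_wstar_closed_on D T :=
  forall (x_ : X ^nat) (f_ : (dual X) ^nat) (x : X) (f : dual X),
  (forall n, D (x_ n)) -> (forall n, T (x_ n) (f_ n)) ->
  x_ @ \oo --> x -> D x -> {weak*, f_ @ \oo --> f} -> T x f.

Definition bounded_map T :=
  forall B : set X, B `<=` dom T -> bounded_set B ->
  dual_bounded (\bigcup_(x in B) T x).

Definition type_Splus_on D T :=
  forall (x_ : X ^nat) (x : X),
  (forall n, D (x_ n)) -> {weak, x_ @ \oo --> x} -> D x ->
  (exists f_ : (dual X) ^nat, (forall n, T (x_ n) (f_ n)) /\
     (0 <= limn_einf (fun n => (f_ n (x - x_ n))%:E))%E) ->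
  x_ @ \oo --> x.

Definition bifun_of T (x y : X) : \bar R :=
  ereal_sup [set (f (y - x))%:E | f in T x].

Definition solutions (G : X -> X -> \bar R) Phi (x : X) : set X :=
  [set z | Phi x z /\ forall y, Phi x y -> (0 <= G z y)%E].

Definition metric_projection C (x : X) : set X :=
  [set z | C z /\ forall w, C w -> `|x - z| <= `|x - w|].

Definition projected_solution C Phi T (x : X) :=
  C x /\ exists2 z, solutions (bifun_of T) Phi x z & metric_projection C z x.

(* Step i is carried out only if the algorithm did not stop at an earlier step;
   after a stop the sequence is continued constantly. *)
Definition generated_by_algorithm C (G : X -> X -> \bar R) Phi (x_ : X ^nat) :=
  [/\ C (x_ 0%N),
      forall i, (forall j, (j < i)%N -> x_ j.+1 <> x_ j) ->
        exists2 z, solutions G Phi (x_ i) z & metric_projection C z (x_ i.+1)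
    & forall i, x_ i.+1 = x_ i -> forall j, (i <= j)%N -> x_ j = x_ i].

Definition asymptotically_regular (x_ : X ^nat) :=
  `|x_ n - x_ n.+1| @[n --> \oo] --> (0 : R).

Definition weak_limit_point (x_ : X ^nat) (p : X) :=
  exists2 k : nat -> nat, increasing_seq k & {weak, (x_ \o k) @ \oo --> p}.

End SetValuedMaps.

(* Main.v *)
Require Import Defs.
From HB Require Import structures.
From mathcomp Require Import all_boot all_order all_algebra.
From mathcomp Require Import all_classical all_reals all_analysis.
From mathcomp Require Import ring lra.

Set Implicit Arguments.
Unset Strict Implicit.
Unset Printing Implicit Defensive.

Import Order.TTheory GRing.Theory Num.Theory.
Import numFieldNormedType.Exports.

Local Open Scope classical_set_scope.
Local Open Scope ring_scope.

(** The weak topology of [C] and of the weak closure of [Phi(C)] is only known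
    to be compact, but in a separable normed space countably many functionals
    separate points, so both sets are weakly sequentially compact. If
    [z_n] denotes the point of [S(x_n)] that the algorithm projects to get
    [x_{n+1}], a subsequence therefore satisfies [x_n -> p] and [z_n -> z]
    weakly, and [z] lies in [Phi(p)] because the graph of [Phi] is weakly
    closed.

    The heart of the proof is that [z_n -> z] strongly along a further
    subsequence. Lower semicontinuity provides [y_n] in [Phi(x_n)] with
    [y_n -> z] strongly. As [z_n] solves the variational inequality on
    [Phi(x_n)], some [f_n] in [T(z_n)] satisfies [f_n(y_n - z_n) > -1/(n+1)].
    The [f_n] are norm bounded, so [f_n(z - z_n)] differs from
    [f_n(y_n - z_n)] by a null sequence and its lower limit is nonnegative:
    this is the hypothesis of the S+ property ([Splus_strong_cvg]).

    With strong convergence at hand the two conditions defining a projected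
    solution pass to the limit. For [y] in [Phi(p)], approximate [y] strongly by
    points of [Phi(x_n)], choose the [f_n] as above, and extract a weak*
    limit, which belongs to [T(z)] ([bifun_ge0_limit]). For the projection,
    asymptotic regularity makes [x_{n+1}] converge weakly to [p] as well, and
    the norm is weakly lower semicontinuous ([metric_projection_limit]).

    Three classical facts are proved on the way: the existence of norming
    functionals (Hahn-Banach), the boundedness of weakly bounded sets (needed
    to exploit the boundedness of [T]) and the sequential form of the
    Banach-Alaoglu theorem. *)

(** * Norming functionals *)

Definition sublinear {R : realType} {V : lmodType R} (p : V -> R) :=
  (forall x y, p (x + y) <= p x + p y) /\
  (forall c x, 0 <= c -> p (c *: x) <= c * p x).

Lemma sublinear0 {R : realType} {V : lmodType R} (p : V -> R) :
  sublinear p -> p 0 = 0.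
Proof.
move=> [pD pZ]; apply/eqP; rewrite eq_le.
have := pZ 0 0 (lexx _); rewrite scale0r mul0r => -> /=.
by have := pD 0 0; rewrite addr0 -{1}(addr0 (p 0)) lerD2l.
Qed.

Lemma sublinear_lb {R : realType} {V : lmodType R} (p : V -> R) x :
  sublinear p -> - p (- x) <= p x.
Proof.
move=> p_sub; rewrite lerNl -subr_ge0 opprK addrC.
by have := p_sub.1 x (- x); rewrite subrr sublinear0.
Qed.

Lemma sublinearZ {R : realType} {V : lmodType R} (p : V -> R) c x :
  sublinear p -> 0 <= c -> p (c *: x) = c * p x.
Proof.
move=> p_sub; rewrite le_eqVlt => /predU1P[<-|c0].
  by rewrite scale0r mul0r sublinear0.
apply/eqP; rewrite eq_le p_sub.2 ?(ltW c0)//= -ler_pdivlMl//.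
have := p_sub.2 c^-1 (c *: x).
by rewrite scalerA mulVf ?gt_eqF// scale1r; apply; rewrite invr_ge0 ltW.
Qed.

Lemma le_infD {R : realType} (A B : set R) m : A !=set0 -> B !=set0 ->
  (forall a b, A a -> B b -> m <= a + b) -> m <= inf A + inf B.
Proof.
move=> A0 B0 mAB; rewrite -lerBlDr; apply: lb_le_inf => // a Aa.
rewrite lerBlDr -lerBlDl; apply: lb_le_inf => // b Bb.
by rewrite lerBlDl mAB.
Qed.

(** For a sublinear [p] and a vector [a], the functional
    [x |-> inf_(t >= 0) (p (x + t a) - t p a)] is again sublinear, lies below
    [p], and is at most [- p a] at [- a]. This single construction yields both
    that minimal sublinear functionals are linear, and that the linear
    functional found below a norm can be made norming at [a]. *)
Section sublinear_shift.
Context {R : realType} {V : lmodType R} (p : V -> R) (a : V).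
Hypothesis p_sub : sublinear p.

Definition shift_values x : set R :=
  [set p (x + t *: a) - t * p a | t in [set t | 0 <= t]].

Definition sublinear_shift x : R := inf (shift_values x).

Lemma shift_values_nonempty x : shift_values x !=set0.
Proof. by exists (p (x + 0 *: a) - 0 * p a); exists 0 => /=. Qed.

Lemma sublinear_shift_le x t : 0 <= t ->
  sublinear_shift x <= p (x + t *: a) - t * p a.
Proof.
move=> t0; apply: ge_inf; last by exists t.
exists (- p (- x)) => _ [s s0 <-].
rewrite -(sublinearZ _ p_sub s0) lerNl opprB lerBlDr.
by rewrite -{1}(addKr x (s *: a)) p_sub.1.
Qed.

Lemma sublinear_shift_sublinear : sublinear sublinear_shift.
Proof.
split=> [x y|c x].
- apply: le_infD; [exact: shift_values_nonempty.. |].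
  move=> _ _ [s s0 <-] [t t0 <-].
  apply: (le_trans (sublinear_shift_le _ (addr_ge0 s0 t0))).
  rewrite scalerDl addrACA mulrDl opprD [leRHS]addrACA lerD2r.
  exact: p_sub.1.
- rewrite le_eqVlt => /predU1P[<-|c0].
    rewrite scale0r mul0r.
    apply: (le_trans (sublinear_shift_le _ (lexx 0))).
    by rewrite scale0r mul0r addr0 subr0 sublinear0.
  rewrite -ler_pdivrMl//; apply: lb_le_inf; first exact: shift_values_nonempty.
  move=> _ [t t0 <-]; rewrite ler_pdivrMl//.
  apply: (le_trans (sublinear_shift_le _ (mulr_ge0 (ltW c0) t0))).
  by rewrite mulrBr mulrA lerD2r -scalerA -scalerDr p_sub.2 // ltW.
Qed.

Lemma sublinear_shift_le_self x : sublinear_shift x <= p x.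
Proof.
apply: (le_trans (sublinear_shift_le _ (lexx 0))).
by rewrite scale0r addr0 mul0r subr0.
Qed.

Lemma sublinear_shiftN : sublinear_shift (- a) <= - p a.
Proof.
apply: (le_trans (sublinear_shift_le _ ler01)).
by rewrite scale1r addNr sublinear0// mul1r sub0r.
Qed.

End sublinear_shift.

(** Zorn's lemma applies because the pointwise infimum of a chain of sublinear
    functionals is sublinear: it is finite, since every [p <= p0] satisfies
    [- p0 (- x) <= - p (- x) <= p x], and subadditive, since two members of a
    chain can be replaced by the smaller one. *)
Lemma minimal_sublinear_below {R : realType} {V : lmodType R} (p0 : V -> R) :
  sublinear p0 -> exists p : V -> R, [/\ sublinear p, forall x, p x <= p0 x &
    forall q, sublinear q -> (forall x, q x <= p x) -> forall x, p x <= q x].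
Proof.
move=> p0_sub.
pose S := {p : V -> R | sublinear p /\ forall x, p x <= p0 x}.
pose ge (p q : S) := `[< forall x, sval q x <= sval p x >].
have s0 : S by exists p0.
have [||A Atot|[p [p_sub pp0]] pmin] := @ZL_preorder S s0 ge.
- by move=> p; apply/asboolP.
- move=> r s t /asboolP rs /asboolP st; apply/asboolP => x.
  exact: le_trans (st x) (rs x).
- have [[a Aa]|A0] := pselect (A !=set0); last first.
    by exists s0 => s As; exfalso; apply: A0; exists s.
  pose E x := [set sval p x | p in A].
  have E0 x : E x !=set0 by exists (sval a x); exists a.
  have Ele x p : A p -> inf (E x) <= sval p x.
    move=> Ap; apply: ge_inf; last by exists p.
    exists (- p0 (- x)) => _ [q Aq <-].
    apply: le_trans (sublinear_lb _ (svalP q).1).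
    by rewrite lerN2 (svalP q).2.
  have q_sub : sublinear (fun x => inf (E x)).
    split=> [x y|c x c0].
      apply: le_infD => // _ _ [p Ap <-] [q Aq <-].
      wlog pq : x y p q Ap Aq / forall x, sval p x <= sval q x.
        move=> H; have [/asboolP qp|/asboolP] := Atot p q Ap Aq; last exact: H.
        by rewrite (addrC x) [leRHS]addrC; exact: H.
      apply: (le_trans (Ele _ _ Ap)).
      by apply: (le_trans ((svalP p).1.1 _ _)); rewrite lerD2l.
    move: c0; rewrite le_eqVlt => /predU1P[<-|c0].
      rewrite scale0r mul0r.
      by apply: (le_trans (Ele _ _ Aa)); rewrite (sublinear0 (svalP a).1).
    rewrite -ler_pdivrMl//; apply: lb_le_inf => // _ [p Ap <-].
    rewrite ler_pdivrMl//; apply: (le_trans (Ele _ _ Ap)).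
    by apply: (svalP p).1.2; exact: ltW.
  have qp0 x : inf (E x) <= p0 x.
    exact: le_trans (Ele _ _ Aa) ((svalP a).2 x).
  exists (exist _ (fun x => inf (E x)) (conj q_sub qp0) : S) => s As.
  by apply/asboolP => x; exact: Ele.
- exists p; split=> // q q_sub qp.
  have qp0 x : q x <= p0 x by exact: le_trans (qp x) (pp0 x).
  by have /asboolP := pmin (exist _ q (conj q_sub qp0) : S) (asboolT qp).
Qed.

(** By minimality [p] is equal to its own shift along any [x], whence
    [p (- x) <= - p x]. A sublinear and odd functional is linear. *)
Lemma minimal_sublinear_linear {R : realType} {V : lmodType R} (p : V -> R) :
  sublinear p ->
  (forall q, sublinear q -> (forall x, q x <= p x) -> forall x, p x <= q x) ->
  forall c x y, p (c *: x + y) = c * p x + p y.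
Proof.
move=> p_sub pmin.
have pN x : p (- x) = - p x.
  apply/eqP; rewrite eq_le; apply/andP; split; last first.
    by have := sublinear_lb (- x) p_sub; rewrite opprK.
  apply: le_trans (sublinear_shiftN x p_sub).
  exact: (pmin _ (sublinear_shift_sublinear x p_sub)
                 (sublinear_shift_le_self x p_sub)).
have pD x y : p (x + y) = p x + p y.
  apply/eqP; rewrite eq_le p_sub.1/=.
  have := p_sub.1 (- x) (- y); rewrite -opprD !pN; lra.
move=> c x y; rewrite pD; congr (_ + _).
have [c0|c0] := leP 0 c; first exact: sublinearZ.
by rewrite -{1}(opprK c) scaleNr pN sublinearZ ?mulNr ?opprK// oppr_ge0 ltW.
Qed.

Lemma dual_of_bounded {R : realType} {X : normedModType R}
    (f : X -> R) (M : R) :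
  (forall c x y, f (c *: x + y) = c * f x + f y) ->
  (forall x, `|f x| <= M * `|x|) -> exists F : dual X, forall x, F x = f x.
Proof.
move=> flin fM.
pose L := GRing.isLinear.Build R X R^o *:%R f flin.
pose F : {linear X -> R^o} := HB.pack f L.
suff Fc : continuous F by exists (Dual Fc).
apply/linear_bounded_continuous/linear_boundedP; near=> r => x.
apply: (le_trans (fM x)); apply: ler_wpM2r => //.
Unshelve. all: by end_near. Qed.

(** A minimal sublinear functional below the shift of the norm along [a] is
    linear, dominated by the norm, and at most [- `|a|] at [- a]. *)
Lemma norming_functional {R : realType} {X : normedModType R} (a : X) :
  exists f : dual X, f a = `|a| /\ forall x, `|f x| <= `|x|.
Proof.
have n_sub : sublinear (fun x : X => `|x|).
  by split=> [x y|c x c0]; [exact: ler_normD|rewrite normrZ ger0_norm].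
have [p [p_sub pn pmin]] :=
  minimal_sublinear_below (sublinear_shift_sublinear a n_sub).
have plin := minimal_sublinear_linear p_sub pmin.
have pN x : p (- x) = - p x.
  by have := plin (-1) x 0; rewrite scaleN1r addr0 sublinear0// addr0 mulN1r.
have p_le x : p x <= `|x|.
  exact: le_trans (pn x) (sublinear_shift_le_self a n_sub x).
have p_norm x : `|p x| <= 1 * `|x|.
  by rewrite mul1r ler_norml p_le andbT lerNl -pN -(normrN x).
have [f fE] := dual_of_bounded plin p_norm; exists f; split=> [|x]; last first.
  by rewrite fE -[leRHS]mul1r.
apply/eqP; rewrite fE eq_le p_le /= -lerN2 -pN.
exact: le_trans (pn _) (sublinear_shiftN a n_sub).
Qed.

(** * Weakly bounded sets *)

(** Uniform boundedness by a gliding hump. If [B] is unbounded, pick [w k] in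
    [B] with [`|w k| > k * 3 ^ k] and set [f := sum_k s_k 3^-k g_k], where [g_k]
    is norming at [w k] and the sign [s_k] is that of the previous partial sum
    at [w k]. Then the partial sum of index [k+1] has size at least
    [3^-k `|w k|] at [w k], and the rest of the series at most half of that, so
    [`|f (w k)| > k / 2] and [f] is unbounded on [B]. *)
Lemma weakly_bounded_bounded {R : realType} {X : normedModType R} (B : set X) :
  (forall f : dual X, exists M : R, forall z, B z -> `|f z| <= M) ->
  bounded_set B.
Proof.
move=> Bw; apply: contrapT => Bunb.
have /choice[w wP] : forall k : nat, exists z, B z /\ k%:R * 3 ^+ k < `|z|.
  move=> k; apply: contrapT => /forallNP wN; apply: Bunb.
  exists (k%:R * 3 ^+ k); split; first exact: num_real.
  move=> M kM z Bz /=; apply: le_trans (ltW kM).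
  by rewrite leNgt; apply/negP => zk; exact: (wN z).
have /choice[g gP] := @norming_functional _ X.
pose c : R := 3^-1.
pose fix F (k : nat) : X -> R := if k is k'.+1
  then fun x =>
    F k' x + (if 0 <= F k' (w k') then 1 else -1) * c ^+ k' * g (w k') x
  else fun=> 0.
(* [r k] is the sum of the geometric tail [c^k + c^(k+1) + ...]. *)
pose r k : R := 3 / 2 * c ^+ k.
have rS k : r k - r k.+1 = c ^+ k by rewrite /r exprS /c; field.
have c_gt0 k : 0 < c ^+ k by rewrite exprn_gt0// invr_gt0.
have r_gt0 k : 0 < r k by rewrite mulr_gt0// divr_gt0.
have Flin k a x y : F k (a *: x + y) = a * F k x + F k y.
  elim: k => [|k IH] /=; first by rewrite mulr0 addr0.
  rewrite IH linearP/=; set s := if _ then _ else _.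
  rewrite -[_ *: _]/(_ * _); ring.
have Fstep k x : `|F k.+1 x - F k x| <= (r k - r k.+1) * `|x|.
  rewrite rS /= addrC addKr !normrM (ger0_norm (ltW (c_gt0 k))).
  have -> : `|if 0 <= F k (w k) then 1 else -1 : R| = 1.
    by case: ifP => _; rewrite ?normrN normr1.
  by rewrite mul1r ler_pM2l// (gP _).2.
have Ftail k n x : (k <= n)%N -> `|F n x - F k x| <= r k * `|x|.
  move=> /subnKC <-; set m := (n - k)%N.
  suff : `|F (k + m)%N x - F k x| <= (r k - r (k + m)%N) * `|x|.
    move/le_trans; apply; rewrite ler_wpM2r//.
    by rewrite gerBl ltW.
  elim: m => [|m IH]; first by rewrite addn0 !subrr normr0 mul0r.
  rewrite addnS; have := Fstep (k + m)%N x.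
  have := ler_normD (F (k + m).+1 x - F (k + m)%N x) (F (k + m)%N x - F k x).
  rewrite addrA subrK; lra.
have rx0 (x : X) : r k * `|x| @[k --> \oo] --> 0.
  have -> : (fun k => r k * `|x|) = geometric (3 / 2 * `|x|) c.
    by apply/funext => k; rewrite /r /= mulrAC.
  by apply: cvg_geometric; rewrite ger0_norm ?invr_ge0// invf_lt1// ltr1n.
have Fcvg x : cvgn (F ^~ x).
  apply/cauchy_cvgP/cauchy_exP => e e0.
  have /cvgrPdist_lt /(_ e e0)[k _ ke] := rx0 x.
  exists (F k x); exists k => // n /= kn.
  rewrite /ball/= distrC (le_lt_trans (Ftail _ _ _ kn))//.
  by have /= := ke k (leqnn k); rewrite sub0r normrN ger0_norm// mulr_ge0// ltW.
pose f x : R := limn (F ^~ x).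
have {}Fcvg x : F n x @[n --> \oo] --> f x by exact: Fcvg.
have fF k x : `|f x - F k x| <= r k * `|x|.
  have : `|F n x - F k x| @[n --> \oo] --> `|f x - F k x|.
    by apply: cvg_norm; apply: cvgB; [exact: Fcvg|exact: cvg_cst].
  move=> /cvgr_to_le; apply.
  by exists k => // n /=; exact: Ftail.
have flin a x y : f (a *: x + y) = a * f x + f y.
  apply: cvg_lim => //; under eq_fun do rewrite Flin.
  by apply: cvgD; [apply: cvgMr|]; exact: Fcvg.
have [h hE] : exists h : dual X, forall x, h x = f x.
  apply: (@dual_of_bounded _ _ f (r 0%N)) => // x.
  by have := fF 0%N x; rewrite /= subr0.
have [M hM] := Bw h.
have hw k : k%:R < 2 * M.
  have [Bw_ wk] := wP k.
  have Fw : c ^+ k * `|w k| <= `|F k.+1 (w k)|.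
    have := mulr_ge0 (ltW (c_gt0 k)) (normr_ge0 (w k)).
    rewrite /= (gP (w k)).1; case: ifPn => Fk cw.
      by rewrite mul1r ger0_norm ?addr_ge0// lerDr.
    move: Fk; rewrite -ltNge => Fk.
    rewrite ler0_norm; last by rewrite mulN1r mulNr; lra.
    by rewrite mulN1r mulNr; lra.
  have := fF k.+1 (w k); have := hM _ Bw_; rewrite hE.
  have : r k.+1 = c ^+ k / 2 by rewrite /r exprS /c; field.
  move=> ->.
  have : k%:R < c ^+ k * `|w k|.
    by rewrite /c exprVn mulrC ltr_pdivlMr// exprn_gt0.
  have := lerB_dist (F k.+1 (w k)) (F k.+1 (w k) - f (w k)).
  rewrite subKr distrC; lra.
have M_gt0 := hw 0%N.
by have := lt_trans (archi_boundP (ltW M_gt0)) (hw _); rewrite ltxx.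
Qed.

(** * Sequential compactness from countable separation *)

Lemma extract_subsequence (P : nat -> nat -> Prop) :
  (forall n N, exists2 m, (N <= m)%N & P n m) ->
  exists2 k : nat -> nat, increasing_seq k & forall n, P n (k n).
Proof.
move=> Pinf.
have /choice[F FP] : forall nN : nat * nat, exists m, (nN.2 <= m)%N /\ P nN.1 m.
  by move=> [n N]; have [m] := Pinf n N; exists m.
pose fix k n := if n is n'.+1 then F (n, (k n').+1) else F (0%N, 0%N).
exists k; first by apply/increasing_seqP => n; exact: (FP (n.+1, (k n).+1)).1.
by case=> [|n]; [exact: (FP (0%N, 0%N)).2|exact: (FP (n.+1, (k n).+1)).2].
Qed.

Lemma increasing_seq_ge (k : nat -> nat) n : increasing_seq k -> (n <= k n)%N.
Proof.
move=> /increasing_seqP k_lt; elim: n => // n IH.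
exact: leq_ltn_trans IH (k_lt n).
Qed.

Lemma increasing_seq_cvg (k : nat -> nat) : increasing_seq k -> k @ \oo --> \oo.
Proof.
move=> k_incr A [N _ NA]; exists N => // n /= Nn; apply: NA => /=.
exact: leq_trans Nn (increasing_seq_ge n k_incr).
Qed.

(** If [F] did not converge to [p], its trace on the complement of some
    neighbourhood of [p] would still be proper and would cluster in [K] at a
    point other than [p]. *)
Lemma compact_unique_cluster_cvg {T : topologicalType} (K : set T) p
    (F : set_system T) : ProperFilter F -> compact K -> F K ->
  (forall q, K q -> cluster F q -> q = p) -> F --> p.
Proof.
move=> PF cptK FK uniq U pU; apply: contrapT => NFU.
pose G := within (~` U) F.
have GP : ProperFilter G.
  apply: Build_ProperFilter_ex => A GA; apply: contrapT => A0; apply: NFU.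
  apply: (@filterS _ F _ _ _ _ GA) => x Ax; apply: contrapT => Ux.
  by apply: A0; exists x; exact: Ax.
have [q [Kq qG]] := cptK G GP (@cvg_within _ F _ _ K FK).
have qp : q = p.
  by apply: uniq => // A B FA qB; apply: qG => //; exact: (@cvg_within _ F _ _ A FA).
have [x [UNx Ux]] : ~` U `&` U !=set0.
  by apply: qG; [exact: withinT|rewrite qp].
exact: UNx.
Qed.

(** The usual metrization of a compact set by countably many continuous
    functions is bypassed: a cluster point [p] of the sequence is given by
    compactness, and a subsequence is chosen along which every [g i] converges
    to [g i p]. Any cluster point of that subsequence agrees with [p] under all
    [g i], hence equals [p], and in a compact set a unique cluster point is a
    limit. *)
Lemma seq_compact_of_countable_separation {R : realType} {T : topologicalType}
    (K : set T) (g : nat -> T -> R) :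
  compact K -> (forall i, continuous (g i)) ->
  (forall p q, K p -> K q -> (forall i, g i p = g i q) -> p = q) ->
  forall u : nat -> T, (forall n, K (u n)) ->
  exists (k : nat -> nat) (p : T),
    [/\ increasing_seq k, K p & (u \o k) @ \oo --> p].
Proof.
move=> cptK gc gsep u Ku.
have [p [Kp up]] : K `&` cluster (u @ \oo) !=set0.
  by apply: cptK; exists 0%N => // n _ /=; exact: Ku.
have [n N|k k_incr kP] := @extract_subsequence
    (fun n m => forall i, (i <= n)%N -> `|g i p - g i (u m)| < n.+1%:R^-1).
  have [x [[m Nm <-] close]] : (u @` [set m | (N <= m)%N]) `&`
      [set x | forall i, (i < n.+1)%N -> `|g i p - g i x| < n.+1%:R^-1] !=set0.
    apply: up; first by exists N => // m Nm; exists m.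
    elim: n.+1 {2}n => [|j IH] n0; first exact: filterE.
    have /cvgrPdist_lt/(_ n0.+1%:R^-1) := gc j p.
    rewrite invr_gt0 ltr0Sn => /(_ isT); apply: filterS2 (IH n0).
    move=> x /= xj gx i; rewrite ltnS leq_eqVlt => /predU1P[->//|]; exact: xj.
  by exists m.
exists k, p; split => //.
apply: (compact_unique_cluster_cvg _ cptK).
  by exists 0%N => // n _ /=; exact: Ku.
move=> q Kq qu; apply: gsep => // i.
have gp : g i (u (k n)) @[n --> \oo] --> g i p.
  apply/cvgrPdist_lt => e e0; near=> n.
  apply: (@lt_trans _ _ n.+1%:R^-1); first by apply: kP; near: n; exists i.
  by near: n; exact: near_infty_natSinv_lt (PosNum e0).
apply/eqP; rewrite -subr_eq0 -normr_le0; apply/ler_addgt0Pr => e e0.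
rewrite add0r.
have e20 : 0 < e / 2 by rewrite divr_gt0.
have [x [xp xq]] : [set x | `|g i p - g i x| < e / 2] `&`
    [set x | `|g i q - g i x| < e / 2] !=set0.
  apply: qu; first by move/cvgrPdist_lt : gp; exact.
  by have /cvgrPdist_lt := gc i q; exact.
rewrite (splitr e) ltW// (le_lt_trans (ler_distD (g i x) _ _))//.
by rewrite ltrD// distrC.
Unshelve. all: by end_near. Qed.

(** * Weak and weak* convergence *)

Lemma dual_normP {R : realType} {X : normedModType R} (f : dual X) x :
  `|f x| <= dual_norm f * `|x|.
Proof.
have [M M0 fM] : exists2 M : R, 0 < M & forall x, `|f x| <= M * `|x|.
  have /linear_bounded_continuous/linear_boundedP := @dual_continuous _ _ f.
  by move=> /pinfty_ex_gt0[M M0 fM]; exists M.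
have [->|x0] := eqVneq x 0; first by rewrite linear0 !normr0 mulr0.
have x_gt0 : 0 < `|x| by rewrite normr_gt0.
rewrite -ler_pdivrMr//.
have -> : `|f x| / `|x| = `|f (`|x|^-1 *: x)|.
  by rewrite linearZ normrM ger0_norm ?invr_ge0// mulrC.
apply: ub_le_sup; last first.
  by exists (`|x|^-1 *: x) => //=; rewrite normrZ ger0_norm ?invr_ge0// mulVf ?gt_eqF//.
exists M => _ [y /= y1 <-]; apply: le_trans (fM y) _.
by rewrite ger_pMr.
Qed.

Lemma weak_cvgP {R : realType} {X : normedModType R}
    (F : set_system X) (x : X) :
  Filter F -> {weak, F --> x} <-> forall f : dual X, f y @[y --> F] --> f x.
Proof.
move=> FF; split=> [Fx f|Fx].
  have Fxf : F --> (x : initial_topology (f : X -> R^o)).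
    exact: ((@cvg_sup _ _ _ _ _ FF).1 Fx f).
  apply: cvg_trans (@initial_continuous _ _ (f : X -> R^o) x).
  exact: cvg_app.
apply/cvg_sup => f U; rewrite nbhsE => -[_ [[A oA <-] /= Afx] AU].
apply: filterS AU _; apply: (Fx f).
exact: open_nbhs_nbhs.
Qed.

Lemma wstar_cvgP {R : realType} {X : normedModType R}
    (F : set_system (dual X)) (f : dual X) :
  Filter F -> {weak*, F --> f} <-> forall x, g x @[g --> F] --> f x.
Proof. by move=> FF; apply: pointwise_cvgP. Qed.

Lemma cvg_weak {R : realType} {X : normedModType R} (F : set_system X) (x : X) :
  Filter F -> F --> x -> {weak, F --> x}.
Proof.
move=> FF Fx; apply/weak_cvgP => f.
exact: cvg_trans (cvg_app _ Fx) (@dual_continuous _ _ f x).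
Qed.

Lemma weak_cvg_bounded {R : realType} {X : normedModType R} (u : X ^nat) x :
  {weak, u @ \oo --> x} -> bounded_set (range u).
Proof.
move=> /weak_cvgP ux; apply: weakly_bounded_bounded => f.
have /cvgP/cvg_has_ub[M fM] := ux f.
by exists M => _ [n _ <-]; apply: fM; exists n.
Qed.

(** * Sequential compactness in separable normed spaces *)

Lemma separable_dense_sequence {R : realType} {X : normedModType R} :
  separable X ->
  exists d : nat -> X, forall x e, 0 < e -> exists n, `|x - d n| < e.
Proof.
move=> [D /countable_injP[i i_inj] dD].
exists (fun n => xget 0 [set x | D x /\ i x = n]).
move=> x e e0.
have [y [yx Dy]] : ball x e `&` D !=set0.
  apply: dD; first by exists x; exact: ballxx.
  exact: ball_open.
exists (i y).
have [Dz iz] : [set x | D x /\ i x = i y] (xget 0 [set x | D x /\ i x = i y]).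
  by apply: xgetPex; exists y.
by move: yx; rewrite -ball_normE /= (i_inj _ _ _ _ iz) ?inE.
Qed.

(** Banach-Alaoglu: linearity and the bound are conditions closed in the
    topology of pointwise convergence, inside a product of segments that is
    compact by Tychonoff's theorem. *)
Lemma bounded_functionals_compact {R : realType} {X : normedModType R} (M : R) :
  compact ([set h | (forall a x y, h (a *: x + y) = a * h x + h y) /\
    forall x, `|h x| <= M * `|x|] : set {ptws X -> R}).
Proof.
have evc (x : X) : continuous (fun h : {ptws X -> R} => h x).
  exact: (@proj_continuous X (fun=> R) x).
have lin (T : topologicalType) (u v w : T -> R) (a : R) : continuous u ->
    continuous v -> continuous w -> continuous (fun h => u h - a * v h - w h).
  move=> uc vc wc h; apply: cvgB; last exact: wc.
  by apply: cvgB; [exact: uc|apply: cvgMr; exact: vc].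
have nrm (T : topologicalType) (u : T -> R) : continuous u ->
    continuous (fun h => `|u h|).
  by move=> uc h; apply: cvg_norm; exact: uc.
have cK : compact [set h : {ptws X -> R} | forall x,
    `[- (M * `|x|), M * `|x| ]%classic (h x)].
  exact: (@tychonoff X (fun=> R) (fun x => `[- (M * `|x|), M * `|x| ]%classic)
    (fun x => @segment_compact R _ _)).
apply: subclosed_compact _ cK _; last first.
  by move=> h [_ hM] x; rewrite /= in_itv/= -ler_norml.
rewrite (_ : mkset _ =
  \bigcap_t [set h | h (t.1.1 *: t.1.2 + t.2) - t.1.1 * h t.1.2 - h t.2 = 0] `&`
  \bigcap_x [set h | `|h x| <= M * `|x| ]); last first.
  apply/seteqP; split=> h /=.
    by move=> [hl hM]; split=> [[[a x] y] _|x _] /=; rewrite ?hl ?hM//; ring.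
  move=> [hl hM]; split=> [a x y|x]; last exact: hM.
  by have /= := hl (a, x, y) I; lra.
apply: closedI; apply: closed_bigI => t _.
  apply: (@preimage_closed _ _ (fun h : {ptws X -> R} => _) [set 0]).
    by move=> h _; exact: (lin _ _ _ _ _ (evc _) (evc _) (evc _)).
  exact: closed_eq.
apply: (@preimage_closed _ _ (fun h : {ptws X -> R} => `|h t|) [set r | r <= M * `|t|]).
  by move=> h _; exact: (nrm _ _ (evc _)).
exact: closed_le.
Qed.

(** Evaluations along a dense sequence separate equicontinuous linear
    functionals. *)
Lemma dual_bounded_seq_compact {R : realType} {X : normedModType R}
    (f_ : nat -> dual X) (M : R) :
  separable X -> (forall n x, `|f_ n x| <= M * `|x|) ->
  exists (k : nat -> nat) (f : dual X),
    increasing_seq k /\ {weak*, (f_ \o k) @ \oo --> f}.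
Proof.
move=> /separable_dense_sequence[d dP] fM.
pose g n (h : {ptws X -> R}) := h (d n).
have [|p q [plin pM] [qlin qM] pq|n|k [h [k_incr [hlin hM] fh]]] :=
  @seq_compact_of_countable_separation R _ _ g
    (@bounded_functionals_compact R X M) _ _ (fun n => f_ n : X -> R) _.
- by move=> n; exact: (@proj_continuous X (fun=> R) (d n)).
- have [P PE] := dual_of_bounded plin pM.
  have [Q QE] := dual_of_bounded qlin qM.
  apply/funext => x; rewrite -PE -QE; apply/eqP.
  rewrite -subr_eq0 -normr_le0; apply/ler_addgt0Pr => e e0; rewrite add0r.
  have M1 : 0 < 2 * (`|M| + 1) by rewrite mulr_gt0// ltr_wpDl.
  have [n xn] := dP x (e / (2 * (`|M| + 1))) (divr_gt0 e0 M1).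
  have -> : P x - Q x = P (x - d n) - Q (x - d n).
    by rewrite !linearB/= !PE !QE -!/(g n _) pq; ring.
  move: xn; rewrite ltr_pdivlMr//.
  have := ler_normB (P (x - d n)) (Q (x - d n)).
  have := pM (x - d n); have := qM (x - d n); rewrite -PE -QE.
  have := ler_wpM2r (normr_ge0 (x - d n)) (ler_norm M).
  have := normr_ge0 (x - d n); lra.
- by split=> [a x y|//]; rewrite linearP.
have [F FE] := dual_of_bounded hlin hM.
exists k, F; split=> //; apply/wstar_cvgP => x; rewrite FE.
exact: (cvg_comp _ _ fh (@proj_continuous X (fun=> R) x h)).
Qed.

(** Functionals norming the points of a dense sequence separate the points of
    the space: if they all vanish at [v], then [`|d n| <= `|v - d n|] for each
    [n], and [d n] may be taken close to [v]. *)
Lemma weakly_compact_seq_compact {R : realType} {X : normedModType R}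
    (K : set X) (u : X ^nat) :
  separable X -> compact (K : set (weak_space X)) -> (forall n, K (u n)) ->
  exists (k : nat -> nat) (p : X),
    [/\ increasing_seq k, K p & {weak, (u \o k) @ \oo --> p}].
Proof.
move=> /separable_dense_sequence[d dP] cptK Ku.
have /choice[g gP] := @norming_functional R X.
apply: (@seq_compact_of_countable_separation R (weak_space X) K
  (fun n => g (d n))) => //.
  move=> n p; have FF := nbhs_filter (p : weak_space X).
  exact: ((@weak_cvgP R X (nbhs (p : weak_space X)) p FF).1
    (@cvg_id _ _) (g (d n))).
move=> p q _ _ pq; apply/eqP; rewrite -subr_eq0 -normr_le0.
apply/ler_addgt0Pr => e e0; rewrite add0r.
have e20 : 0 < e / 2 by rewrite divr_gt0.
have [n pqn] := dP (p - q) (e / 2) e20.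
have := (gP (d n)).2 (p - q - d n).
rewrite !linearB/= pq subrr sub0r normrN (gP (d n)).1 normr_id.
have := lerB_dist (p - q) (d n); lra.
Qed.

(** * Subsequences and limits *)

Lemma cvg_subsequence {T : topologicalType} (u : nat -> T)
    (k : nat -> nat) (p : T) :
  increasing_seq k -> u @ \oo --> p -> (u \o k) @ \oo --> p.
Proof. by move=> /increasing_seq_cvg k_oo up; exact: (cvg_comp _ _ k_oo up). Qed.

Lemma increasing_seq_comp (k l : nat -> nat) :
  increasing_seq k -> increasing_seq l -> increasing_seq (k \o l).
Proof. by move=> k_incr l_incr m n; rewrite /= k_incr; exact: l_incr. Qed.

Lemma cvg_weak_asymptotic {R : realType} {X : normedModType R}
    (u v : X ^nat) (p : X) :
  {weak, u @ \oo --> p} -> `|u n - v n| @[n --> \oo] --> (0 : R) ->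
  {weak, v @ \oo --> p}.
Proof.
move=> /weak_cvgP up /norm_cvg0P uv0; apply/weak_cvgP => f.
have fuv : f (u n - v n) @[n --> \oo] --> f 0.
  exact: cvg_comp _ _ uv0 (@dual_continuous _ _ f 0).
have fu : f (u n) @[n --> \oo] --> f p by exact: up.
suff : f (v n) @[n --> \oo] --> f p by [].
have -> : (fun n => f (v n)) = (fun n => f (u n) - f (u n - v n)).
  by apply/funext => n; rewrite -linearB opprB addrC subrK.
by rewrite -[f p]subr0 -(linear0 f); exact: cvgB.
Qed.

Lemma limn_einf_ge0 {R : realType} (a u : R ^nat) :
  a @ \oo --> 0 -> (forall n, a n <= u n) ->
  (0 <= limn_einf (fun n => (u n)%:E))%E.
Proof.
move=> a0 au; apply/lee_addgt0Pr => e e0.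
rewrite limn_einf_lim -leeBlDr// add0e; apply: lime_ge.
  exact: is_cvg_einfs.
move/cvgrPdist_lt : a0 => /(_ e e0)[N _ aN]; exists N => // n /= Nn.
apply: le_ereal_inf_tmp => _ [m /= nm <-]; rewrite lee_fin.
have := aN m (leq_trans Nn nm); rewrite /= sub0r normrN ltr_norml => /andP[].
have := au m; lra.
Qed.

(** * Passing to the limit in the variational inequality *)

Lemma weakly_closed_limit {R : realType} {X : normedModType R} (C : set X)
    (Phi : X -> set X) (u v : X ^nat) (p z : X) :
  weakly_closed C Phi -> (forall n, C (u n)) -> (forall n, Phi (u n) (v n)) ->
  {weak, u @ \oo --> p} -> C p -> {weak, v @ \oo --> z} -> Phi p z.
Proof.
move=> /closed_subspaceP[V cV VE] Cu Phiuv up Cp vz.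
have VPhi q : C q.1 -> V q <-> Phi q.1 q.2.
  move=> Cq; have /seteqP[VE1 VE2] := VE; split=> [Vq|Pq].
    by have [] := VE1 q (conj Vq (conj Cq I)) => -[].
  by have [] := VE2 q (conj (conj Cq Pq) (conj Cq I)).
apply/(VPhi (p, z)) => //.
have uv : (fun n => (u n, v n) : weak_space X * weak_space X) @ \oo -->
    ((p, z) : weak_space X * weak_space X) by exact: cvg_pair up vz.
apply: closed_cvg cV _ _ uv.
by exists 0%N => // n _; apply/VPhi; [exact: Cu|exact: Phiuv].
Qed.

Lemma bifun_approx {R : realType} {X : normedModType R} (T : X -> set (dual X))
    (z y : X) (e : R) : (0 <= bifun_of T z y)%E -> 0 < e ->
  exists f : dual X, T z f /\ - e < f (y - z).
Proof.
move=> Gzy e0.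
have /ereal_sup_gt[_ [f Tf <-]] : ((- e)%:E < bifun_of T z y)%E.
  by apply: lt_le_trans Gzy; rewrite lte_fin oppr_lt0.
by rewrite lte_fin; exists f.
Qed.

(** The supremum defining [bifun_of] need not be attained, so approximate
    maximizers with errors tending to [0] are used in its place. *)
Lemma bifun_approx_seq {R : realType} {X : normedModType R}
    (T : X -> set (dual X)) (z_ y_ : X ^nat) :
  bounded_map T -> bounded_set (range z_) ->
  (forall n, 0 <= bifun_of T (z_ n) (y_ n))%E ->
  exists (f_ : nat -> dual X) (M : R),
    [/\ forall n, T (z_ n) (f_ n), forall n x, `|f_ n x| <= M * `|x| &
      forall n, - n.+1%:R^-1 < f_ n (y_ n - z_ n)].
Proof.
move=> bT bz Gzy.
have /choice[f_ fP] n : exists f : dual X,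
    T (z_ n) f /\ - n.+1%:R^-1 < f (y_ n - z_ n).
  by apply: bifun_approx => //; rewrite invr_gt0.
have [|M TM] := bT _ _ bz.
  by move=> _ [n _ <-]; exists (f_ n); exact: (fP n).1.
exists f_, M; split=> [n|n x|n]; [exact: (fP n).1| |exact: (fP n).2].
apply: le_trans (dual_normP _ _) _; rewrite ler_wpM2r//.
by apply: TM; exists (z_ n); [exists n|exact: (fP n).1].
Qed.

Lemma bounded_functionals_cvg0 {R : realType} {X : normedModType R}
    (f_ : nat -> dual X) (M : R) (u : X ^nat) :
  (forall n x, `|f_ n x| <= M * `|x|) -> u @ \oo --> (0 : X) ->
  f_ n (u n) @[n --> \oo] --> (0 : R).
Proof.
move=> fM /cvg_norm; rewrite normr0 => u0.
apply/norm_cvg0P; apply: (squeeze_cvgr _ (cvg_cst 0)).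
  by exists 0%N => // n _ /=; rewrite normr_ge0; exact: fM.
by rewrite -[X in _ --> X](mulr0 M); apply: cvgMr; exact: u0.
Qed.

(** Write [z - z_n = (z - y_n) + (y_n - z_n)]. Approximate maximizers [f_n] are
    uniformly bounded, so [f_n (z - y_n)] tends to [0], while
    [f_n (y_n - z_n)] is bounded below by a null sequence. *)
Lemma Splus_strong_cvg {R : realType} {X : normedModType R} (D : set X)
    (T : X -> set (dual X)) (z_ y_ : X ^nat) (z : X) :
  bounded_map T -> type_Splus_on D T -> (forall n, D (z_ n)) -> D z ->
  {weak, z_ @ \oo --> z} -> y_ @ \oo --> z ->
  (forall n, 0 <= bifun_of T (z_ n) (y_ n))%E -> z_ @ \oo --> z.
Proof.
move=> bT ST Dz_ Dz zz yz Gzy.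
have [f_ [M [Tf fM fe]]] := bifun_approx_seq bT (weak_cvg_bounded zz) Gzy.
apply: ST => //; exists f_; split=> //.
have fy0 : f_ n (z - y_ n) @[n --> \oo] --> (0 : R).
  apply: bounded_functionals_cvg0 fM _.
  by rewrite -[X in _ --> X](subrr z); apply: cvgB => //; exact: cvg_cst.
apply: (@limn_einf_ge0 _ (fun n => f_ n (z - y_ n) - n.+1%:R^-1)).
  by rewrite -[X in _ --> X](subr0 0); apply: cvgB => //; exact: cvg_harmonic.
move=> n; have -> : f_ n (z - z_ n) = f_ n (z - y_ n) + f_ n (y_ n - z_ n) :> R.
  by rewrite -linearD addrA subrK.
by apply: lerD => //; exact: ltW.
Qed.

(** A weak* limit [f] of approximate maximizers [f_n] belongs to [T z]; since
    [y_n - z_n] converges strongly and the [f_n] are bounded,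
    [f (y - z)] is the limit of [f_n (y_n - z_n)], hence nonnegative. *)
Lemma bifun_ge0_limit {R : realType} {X : normedModType R} (D : set X)
    (T : X -> set (dual X)) (z_ y_ : X ^nat) (z y : X) :
  separable X -> bounded_map T -> s_wstar_closed_on D T ->
  (forall n, D (z_ n)) -> D z -> z_ @ \oo --> z -> y_ @ \oo --> y ->
  (forall n, 0 <= bifun_of T (z_ n) (y_ n))%E -> (0 <= bifun_of T z y)%E.
Proof.
move=> sepX bT cT Dz_ Dz zz yy Gzy.
have bz : bounded_set (range z_) by apply: weak_cvg_bounded (cvg_weak _ zz).
have [f_ [M [Tf fM fe]]] := bifun_approx_seq bT bz Gzy.
have [k [f [k_incr ff]]] := dual_bounded_seq_compact sepX fM.
have Tzf : T z f.
  by apply: cT (cvg_subsequence k_incr zz) Dz ff => n; [exact: Dz_|exact: Tf].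
apply: (@le_trans _ _ (f (y - z))%:E); last by apply: ereal_sup_ubound; exists f.
rewrite lee_fin.
have yz0 : y_ n - z_ n - (y - z) @[n --> \oo] --> (0 : X).
  rewrite -[X in _ --> X](subrr (y - z)).
  by apply: cvgB; [exact: cvgB|exact: cvg_cst].
have fyz : f_ (k n) (y_ (k n) - z_ (k n)) @[n --> \oo] --> f (y - z).
  have f0 : f_ (k n) (y_ (k n) - z_ (k n) - (y - z)) @[n --> \oo] --> (0 : R).
    exact: (bounded_functionals_cvg0 (fun n => fM (k n))
      (cvg_subsequence k_incr yz0)).
  have f1 : f_ (k n) (y - z) @[n --> \oo] --> f (y - z).
    by move/wstar_cvgP : ff; exact.
  have -> : (fun n => f_ (k n) (y_ (k n) - z_ (k n))) =
      (fun n => f_ (k n) (y_ (k n) - z_ (k n) - (y - z)) + f_ (k n) (y - z)).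
    by apply/funext => n; rewrite -linearD subrK.
  by rewrite -[f _]add0r; exact: cvgD.
have e0 : - (k n).+1%:R^-1 @[n --> \oo] --> (0 : R).
  rewrite -[X in _ --> X]oppr0; apply: cvgN.
  exact: (cvg_subsequence k_incr cvg_harmonic).
apply: (ler_cvg_to e0 fyz).
by exists 0%N => // n _ /=; apply: ltW.
Qed.

(** A functional norming [z - p] gives
    [`|z - p| = lim g (z_n - w_n) <= lim `|z_n - w|] for [w] in [C]. *)
Lemma metric_projection_limit {R : realType} {X : normedModType R} (C : set X)
    (z_ w_ : X ^nat) (z p : X) :
  C p -> (forall n, metric_projection C (z_ n) (w_ n)) ->
  z_ @ \oo --> z -> {weak, w_ @ \oo --> p} -> metric_projection C z p.
Proof.
move=> Cp Pw zz wp; split=> // w Cw.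
have [g [gzp g1]] := norming_functional (z - p); rewrite -gzp.
have gzw : g (z_ n - w_ n) @[n --> \oo] --> g (z - p).
  have gz : g (z_ n) @[n --> \oo] --> g z.
    by move/cvg_weak/weak_cvgP : zz; exact.
  have gw : g (w_ n) @[n --> \oo] --> g p by move/weak_cvgP : wp; exact.
  have -> : (fun n => g (z_ n - w_ n)) = (fun n => g (z_ n) - g (w_ n)).
    by apply/funext => n; rewrite linearB.
  by rewrite linearB; exact: cvgB.
have nzw : `|z_ n - w| @[n --> \oo] --> `|z - w|.
  by apply: cvg_norm; apply: cvgB => //; exact: cvg_cst.
apply: (ler_cvg_to gzw nzw); exists 0%N => // n _ /=.
apply: le_trans (ler_norm _) _; apply: le_trans (g1 _) _.
exact: (Pw n).2.
Qed.

(** After a stop at step [j], the constant continuation still follows the rule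
    of the algorithm, because [x_{j+1} = x_j] was itself obtained as a
    projection of a point of [S(x_j)]. Hence stopping needs no separate
    treatment. *)
Lemma algorithm_step {R : realType} {X : normedModType R} (C : set X) G
    (Phi : X -> set X) (x_ : X ^nat) n :
  generated_by_algorithm C G Phi x_ ->
  exists2 z, solutions G Phi (x_ n) z & metric_projection C z (x_ n.+1).
Proof.
move=> [_ step stop]; elim/ltn_ind: n => n IH.
have [/step//|] := pselect (forall j, (j < n)%N -> x_ j.+1 <> x_ j).
move=> /existsNP[j /not_implyP[jn /contrapT xj]].
rewrite (stop j xj n (ltnW jn)) (stop j xj n.+1 (leqW (ltnW jn))).
by have [z Sz] := IH j jn; rewrite xj; exists z.
Qed.

(** * Convergence of the algorithm *)

Theorem theorem4p3 (R : realType) (X : normedModType R) (sepX : separable X)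
    (C : set X) (C0 : C !=set0) (cvxC : convex_set C)
    (cptC : compact (C : set (weak_space X)))
    (Phi : X -> set X)
    (Phi0 : forall x, C x -> Phi x !=set0)
    (cvxPhi : forall x, C x -> convex_set (Phi x))
    (cptPhi : precompact (image_set C Phi : set (weak_space X)))
    (lscPhi : forall x, C x -> seq_weakly_lsc_at C Phi x)
    (closedPhi : weakly_closed C Phi)
    (T : X -> set (dual X))
    (domT : image_set C Phi `<=` dom T)
    (closedT : s_wstar_closed_on (image_set C Phi) T)
    (boundedT : bounded_map T)
    (SplusT : type_Splus_on (image_set C Phi) T)
    (x_ : X ^nat) (genx : generated_by_algorithm C (bifun_of T) Phi x_)
    (regx : asymptotically_regular x_) :
  exists p : X, weak_limit_point x_ p /\ projected_solution C Phi T p.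
Proof.
have /choice[z_ zP] n : exists z, solutions (bifun_of T) Phi (x_ n) z /\
    metric_projection C z (x_ n.+1).
  by have [z] := algorithm_step n genx; exists z.
have Phiz n : Phi (x_ n) (z_ n) by case: (zP n) => -[].
have Gz n y : Phi (x_ n) y -> (0 <= bifun_of T (z_ n) y)%E.
  by case: (zP n) => -[_ +] _; apply.
have Pz n : metric_projection C (z_ n) (x_ n.+1) by case: (zP n).
have Cx n : C (x_ n) by case: n => [|n]; [case: genx|case: (Pz n)].
have Dz n : image_set C Phi (z_ n) by exists (x_ n).
have [k [p [k_incr Cp xp]]] := weakly_compact_seq_compact sepX cptC Cx.
have [l [z [l_incr _ zz]]] : exists (l : nat -> nat) (z : X), [/\ increasing_seq l,
    closure (image_set C Phi : set (weak_space X)) z &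
    {weak, (z_ \o k \o l) @ \oo --> z}].
  apply: weakly_compact_seq_compact => //; first by rewrite -precompactE.
  by move=> n; apply: subset_closure; exact: Dz.
have {}xp : {weak, (x_ \o k \o l) @ \oo --> p}.
  exact: (@cvg_subsequence (weak_space X) _ _ p l_incr xp).
have Phipz : Phi p z.
  by apply: (weakly_closed_limit closedPhi _ _ xp Cp zz) => n;
    [exact: Cx|exact: Phiz].
have Dzz : image_set C Phi z by exists p.
(* Lower semicontinuity is applied at the limit [z] itself, to make
   [z_n] converge strongly. *)
have [m [m_incr [y_ [Phiy yz]]]] := lscPhi p Cp _ (fun n => Cx _) xp z Phipz.
pose s := k \o l \o m.
have s_incr : increasing_seq s by do 2 apply: increasing_seq_comp.
have {}xp : {weak, (x_ \o s) @ \oo --> p}.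
  exact: (@cvg_subsequence (weak_space X) _ _ p m_incr xp).
have {}zz : {weak, (z_ \o s) @ \oo --> z}.
  exact: (@cvg_subsequence (weak_space X) _ _ z m_incr zz).
have {}zz : (z_ \o s) @ \oo --> z.
  apply: (Splus_strong_cvg boundedT SplusT _ Dzz zz yz) => n; first exact: Dz.
  exact/Gz/Phiy.
exists p; split; first by exists s.
split=> //; exists z; last first.
  apply: (@metric_projection_limit _ _ _ (z_ \o s) (x_ \o S \o s)) => //.
    by move=> n; exact: Pz.
  apply: cvg_weak_asymptotic xp _.
  exact: (cvg_subsequence s_incr regx).
split=> // y Phipy.
have [j [j_incr [v_ [Phiv vy]]]] := lscPhi p Cp _ (fun n => Cx _) xp y Phipy.
apply: (bifun_ge0_limit sepX boundedT closedT _ Dzz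
  (cvg_subsequence j_incr zz) vy) => n; first exact: Dz.
exact/Gz/Phiv.
Qed.
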